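(* Let $K$ be a compact subset of $\mathbb{R}^n$, and let $N:K\to\mathbb{R}^n$ be a continuous mapping such that $|N(y)|=1$ for every $y\in K$. Then the following statements are equivalent: (1) There exists a $C^1$ convex body $V$ with $0\in\mathrm{int}(V)$ such that $K\subseteq\partial V$ and $N(y)$ is outwardly normal to $\partial V$ at $y$ for every $y\in K$. (2) The following three conditions hold: $\langle N(y),y\rangle>0$ for all $y\in K$; $\langle N(y),x-y\rangle\leq0$ for all $x,y\in K$; and, for all $x,y\in K$, $\langle N(y),x-y\rangle=0$ implies $N(x)=N(y)$.
   Context: A convex body is a compact convex subset of $\mathbb{R}^n$ with nonempty interior; it is a $C^1$ convex body if its boundary is a hypersurface of class $C^1$. *)

(* Defs.v *)
From HB Require Import structures.
From mathcomp Require Import all_boot all_order all_algebra.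
From mathcomp Require Import all_classical all_reals all_analysis.

Set Implicit Arguments.
Unset Strict Implicit.
Unset Printing Implicit Defensive.

Import Order.TTheory GRing.Theory Num.Theory.
Import numFieldNormedType.Exports.

Local Open Scope classical_set_scope.
Local Open Scope ring_scope.

Definition dotv (R : realType) (n : nat) (u v : 'rV[R]_n) : R :=
  \sum_(i < n) u ord0 i * v ord0 i.

(* The library norm `|v| on 'rV[R]_n is the sup norm, whence this definition.
   Both norms induce the same topology and the same differentials. *)
Definition enorm (R : realType) (n : nat) (v : 'rV[R]_n) : R :=
  Num.sqrt (dotv v v).

Definition boundary (T : topologicalType) (A : set T) : set T :=
  closure A `\` A°.

Definition convex_body (R : realType) (n : nat) (V : set 'rV[R]_n) : Prop :=
  [/\ compact V, convex_set (V : set (convex_lmodType 'rV[R]_n)) & V° !=set0].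

(* Intended for U open and E finite dimensional; the differential is then
   continuous in operator norm iff x |-> 'd f x v is continuous for every v. *)
Definition C1_on (R : realType) (E F : normedModType R) (U : set E)
    (f : E -> F) : Prop :=
  (forall x, U x -> differentiable f x) /\
  (forall v : E, {within U, continuous (fun x => 'd f x v)}).

(* Locally the zero set of a C^1 function with nonvanishing differential. *)
Definition C1_hypersurface (R : realType) (n : nat) (S : set 'rV[R]_n) : Prop :=
  forall p, S p -> exists (U : set 'rV[R]_n) (g : 'rV[R]_n -> R),
    [/\ open U, U p, C1_on U g,
        forall x, U x -> exists v, 'd g x v != 0
      & S `&` U = [set x | U x /\ g x = 0]].

Definition C1_convex_body (R : realType) (n : nat) (V : set 'rV[R]_n) : Prop :=
  convex_body V /\ C1_hypersurface (boundary V).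

(* Velocities at p of the C^1 curves lying in S; when S is a C^1 hypersurface
   this is the tangent space of S at p. *)
Definition tangent_space (R : realType) (n : nat) (S : set 'rV[R]_n)
    (p : 'rV[R]_n) : set 'rV[R]_n :=
  [set w | exists (e : R) (gamma : R -> 'rV[R]_n),
    [/\ 0 < e, C1_on `]-e, e[ gamma,
        forall t, t \in `]-e, e[ -> S (gamma t),
        gamma 0 = p & derive1 gamma 0 = w]].

(* nu is orthogonal to the boundary of V at y, and points out of V. *)
Definition outward_normal (R : realType) (n : nat) (V : set 'rV[R]_n)
    (y nu : 'rV[R]_n) : Prop :=
  (forall w, tangent_space (boundary V) y w -> dotv nu w = 0) /\
  (\forall t \near (0 : R)^'+, ~ V (y + t *: nu)).

(* Main.v *)
Require Import Defs.
From HB Require Import structures.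
From mathcomp Require Import all_boot all_order all_algebra.
From mathcomp Require Import all_classical all_reals all_analysis.
From mathcomp Require Import ring lra.

(** From (1) to (2): the implicit function theorem in the plane spanned by a
    tangent and a transversal direction shows that the tangent space of the
    boundary at [y] is the whole hyperplane orthogonal to [N y]; convexity then
    makes this hyperplane a supporting one, and the only one at [y].

    From (2) to (1): prescribe the value [0] and the slope [N y] at each [y] of [K],
    the value [-c < 0] and the slope [0] at the origin, and let [a_i] be the
    resulting affine functions. Let [F] be the largest convex function below all
    parabolas [a_i(x) + eta + C |x - y_i|^2] whose constants [(eta, C)] are such that
    every [a_j] and a fixed coercive function lie below all of them. Condition (2)
    and compactness provide such constants with [eta + C r^2 <= e r] for small [r];
    then [x |-> (F(x + h) + F(x - h)) / 2 - e |h|] is again convex and below these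
    parabolas, hence below [F]. So the second differences of [F] are [o(|h|)]
    uniformly, which makes the convex function [F] of class C^1, and [F <= 0] is
    the required body. *)

Set Implicit Arguments.
Unset Strict Implicit.
Unset Printing Implicit Defensive.

Import Order.TTheory GRing.Theory Num.Theory.
Import numFieldNormedType.Exports.

Local Open Scope classical_set_scope.
Local Open Scope ring_scope.

(** * The Euclidean inner product, compared with the sup norm *)

Section dot_product.
Context {R : realType} {n : nat}.
Implicit Types u v w : 'rV[R]_n.

Lemma dotvC u v : dotv u v = dotv v u.
Proof. by apply: eq_bigr => i _; rewrite mulrC. Qed.

Lemma dotvDr u v w : dotv u (v + w) = dotv u v + dotv u w.
Proof. by rewrite -big_split; apply: eq_bigr => i _; rewrite mxE mulrDr. Qed.

Lemma dotvZr a u v : dotv u (a *: v) = a * dotv u v.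
Proof. by rewrite /dotv big_distrr; apply: eq_bigr => i _; rewrite mxE mulrCA. Qed.

Lemma dotvNr u v : dotv u (- v) = - dotv u v.
Proof. by rewrite -scaleN1r dotvZr mulN1r. Qed.

Lemma dotvBr u v w : dotv u (v - w) = dotv u v - dotv u w.
Proof. by rewrite dotvDr dotvNr. Qed.

Lemma dotv0r u : dotv u 0 = 0.
Proof. by rewrite -(scale0r 0) dotvZr mul0r. Qed.

Lemma dotvDl u v w : dotv (u + v) w = dotv u w + dotv v w.
Proof. by rewrite dotvC dotvDr !(dotvC w). Qed.

Lemma dotvZl a u v : dotv (a *: u) v = a * dotv u v.
Proof. by rewrite dotvC dotvZr dotvC. Qed.

Lemma dotvNl u v : dotv (- u) v = - dotv u v.
Proof. by rewrite dotvC dotvNr dotvC. Qed.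

Lemma dotvBl u v w : dotv (u - v) w = dotv u w - dotv v w.
Proof. by rewrite dotvDl dotvNl. Qed.

Lemma coord_le_norm v i : `|v ord0 i| <= `|v|.
Proof.
by rewrite [leRHS]/Num.norm /= mx_normrE; apply/bigmax_geP; right; exists (ord0, i).
Qed.

Lemma dotv_le_norm u v : `|dotv u v| <= n%:R * (`|u| * `|v|).
Proof.
rewrite (le_trans (ler_norm_sum _ _ _))// mulr_natl -[X in _ *+ X]card_ord -sumr_const.
by apply: ler_sum => i _; rewrite normrM ler_pM // coord_le_norm.
Qed.

Lemma dotvv_ge0 v : 0 <= dotv v v.
Proof. by apply: sumr_ge0 => i _; rewrite -expr2 sqr_ge0. Qed.

(** The sup norm is attained at some coordinate, whose square is one of the nonnegative summands. *)
Lemma sqr_norm_le_dotv v : `|v| ^+ 2 <= dotv v v.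
Proof.
have [->|v0] := eqVneq v 0; first by rewrite normr0 expr0n dotvv_ge0.
have [[i j] /= ->] : exists i, `|v| = `|v i.1 i.2|.
  by apply: mx_norm_neq0; rewrite -[mx_norm _]/`|v| normr_eq0.
rewrite (ord1 i) real_normK ?num_real // /dotv (bigD1 j) //= -expr2 lerDl.
by apply: sumr_ge0 => k _; rewrite -expr2 sqr_ge0.
Qed.

Lemma dotvv_gt0 v : v != 0 -> 0 < dotv v v.
Proof.
move=> v0; apply: lt_le_trans (sqr_norm_le_dotv v).
by rewrite exprn_gt0 // normr_gt0.
Qed.

Lemma dotv_continuous u : continuous (dotv u).
Proof.
have lin : linear (dotv u) by move=> a v w; rewrite dotvDr dotvZr.
pose lM := GRing.isLinear.Build _ _ _ _ _ lin.
pose l : {linear 'rV[R]_n -> R} := HB.pack (dotv u) lM.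
apply: (@bounded_linear_continuous _ _ _ l); apply/linear_boundedP.
near=> r => v; rewrite (le_trans (dotv_le_norm u v)) // mulrA ler_wpM2r //.
Unshelve. all: by end_near. Qed.

End dot_product.

(** * Convex functions with uniformly small second differences are C^1 *)

Definition convex_fun (R : realType) (E : lmodType R) (F : E -> R) : Prop :=
  forall (x y : E) (t : R), 0 <= t -> t <= 1 ->
    F (t *: x + (1 - t) *: y) <= t * F x + (1 - t) * F y.

(** Second differences are [o(|h|)] uniformly in [x]. A one-sided bound is enough because it is
    applied to convex functions, whose second differences are nonnegative. *)
Definition uniformly_smooth (R : realType) (E : normedModType R)
    (F : E -> R) : Prop :=
  forall e : R, 0 < e -> exists2 d : R, 0 < d &
    forall x h : E, `|h| < d -> F (x + h) + F (x - h) - 2 * F x <= e * `|h|.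

Lemma ler_add_epsM (R : realType) (a b c : R) : 0 <= c ->
  (forall e, 0 < e -> a <= b + e * c) -> a <= b.
Proof.
move=> c0 h; apply/ler_addgt0Pr => e e0.
have c1 : 0 < c + 1 by lra.
apply: (le_trans (h (e / (c + 1)) (divr_gt0 e0 c1))).
rewrite lerD2l mulrAC ler_pdivrMr //; nra.
Qed.

Lemma differentiable_of_remainder (R : realType) (V W : normedModType R)
    (f : V -> W) (L : {linear V -> W}) (x : V) :
  continuous L ->
  (forall e : R, 0 < e ->
    \forall h \near 0, `|f (x + h) - f x - L h| <= e * `|h|) ->
  differentiable f x /\ 'd f x = L :> (V -> W).
Proof.
move=> Lc rem.
have fo : f \o shift x = cst (f x) + L +o_ 0 id.
  apply/eqaddoP => e /rem; apply: filterS => h /=.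
  by rewrite -[(_ - _) h]/(f (h + x) - (f x + L h)) opprD addrA (addrC h).
have D : 'd f x = L :> (V -> W) by exact: diff_unique.
(* [differentiable] is phrased through ['d f x] itself, so [L] has to be identified with it
   beforehand. *)
by split=> //; apply/diff_locallyP; rewrite D.
Qed.

Section convex_uniformly_smooth.
Context {R : realType} {n : nat}.
Variable F : 'rV[R]_n -> R.
Hypotheses (Fconvex : convex_fun F) (Fsmooth : uniformly_smooth F).
Implicit Types (x u v h : 'rV[R]_n) (t s e : R).

Let quot x v t := (F (x + t *: v) - F x) / t.

(** The point [x] is the convex combination of [x + t v] and [x - s v] with weights [s / (s + t)]
    and [t / (s + t)]. *)
Let three_slopes x v s t : 0 < s -> 0 < t ->
  t * (F x - F (x - s *: v)) <= s * (F (x + t *: v) - F x).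
Proof.
move=> s0 t0; have st : 0 < s + t by rewrite addr_gt0.
have := @Fconvex (x + t *: v) (x - s *: v) (s / (s + t)).
have -> : 1 - s / (s + t) = t / (s + t) by field; rewrite gt_eqF.
have -> : (s / (s + t)) *: (x + t *: v) + (t / (s + t)) *: (x - s *: v) = x.
  by apply/rowP => i; rewrite !mxE; field; rewrite gt_eqF.
move=> /(_ (divr_ge0 (ltW s0) (ltW st))).
rewrite ler_pdivrMr // mul1r lerDl (ltW t0) => /(_ isT).
rewrite -(mulrAC s) -(mulrAC t) -mulrDl ler_pdivlMr //; lra.
Qed.

(** The right directional derivative: the difference quotients of a convex function decrease as [t]
    tends to [0+], so their limit is an infimum, bounded below by backward slopes. *)
Let dd x v := inf [set quot x v t | t in [set t | 0 < t]].

Let quot_lb x v s : 0 < s ->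
  lbound [set quot x v t | t in [set t | 0 < t]] ((F x - F (x - s *: v)) / s).
Proof.
move=> s0 _ [t /= t0 <-]; rewrite ler_pdivlMr // mulrAC ler_pdivrMr //.
by have := three_slopes x v s0 t0; lra.
Qed.

Let dd_le x v t : 0 < t -> t * dd x v <= F (x + t *: v) - F x.
Proof.
move=> t0; rewrite mulrC -ler_pdivlMr //; apply: ge_inf; last by exists t.
by exists ((F x - F (x - 1 *: v)) / 1); exact: quot_lb.
Qed.

Let dd_ge x v s : 0 < s -> F x - F (x - s *: v) <= s * dd x v.
Proof.
move=> s0; rewrite mulrC -ler_pdivrMr //; apply: lb_le_inf; last exact: quot_lb.
by exists (quot x v 1); exists 1 => //=; exact: ltr01.
Qed.

(** Smoothness bounds the forward increment by the backward one, which is at most [t * dd x v]. The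
    radius [d] depends neither on [x] nor on [v]. *)
Let dd_ub e : 0 < e -> exists2 d : R, 0 < d & forall x v t, 0 < t ->
  t * `|v| < d -> F (x + t *: v) - F x <= t * dd x v + e * (t * `|v|).
Proof.
move=> e0; have [d d0 hd] := Fsmooth e0; exists d => // x v t t0 tv.
have ntv : `|t *: v| = t * `|v| by rewrite normrZ gtr0_norm.
have := hd x (t *: v); rewrite ntv => /(_ tv).
by have := dd_ge x v t0; lra.
Qed.

Let exists_small e a : 0 <= a -> 0 < e -> exists2 t : R, 0 < t & t * a < e.
Proof.
move=> a0 e0; exists (e / (a + 1)); first by rewrite divr_gt0 // ltr_wpDl.
by rewrite mulrAC ltr_pdivrMr ?ltr_wpDl // ltr_pM2l // ltrDl.
Qed.

(** The midpoint of [x + t u] and [x + t v] is [x + (t / 2)(u + v)]; convexity there gives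
    subadditivity up to an error that is [o(t)]. *)
Let ddD_le x u v : dd x (u + v) <= dd x u + dd x v.
Proof.
apply: (@ler_add_epsM _ _ _ (`|u| + `|v|)); first by rewrite addr_ge0.
move=> e e0; have [d d0 hd] := dd_ub e0.
have [t t0 ht] := exists_small (addr_ge0 (normr_ge0 u) (normr_ge0 v)) d0.
have h0 : 0 < t / 2 by rewrite divr_gt0.
have := @Fconvex (x + t *: u) (x + t *: v) 2^-1.
have -> : 2^-1 *: (x + t *: u) + (1 - 2^-1) *: (x + t *: v)
    = x + (t / 2) *: (u + v) by apply/rowP => i; rewrite !mxE; field.
move=> /(_ ltac:(lra) ltac:(lra)).
have := hd x u t t0; have := hd x v t t0.
have nu := normr_ge0 u; have nv := normr_ge0 v.
move=> /(_ ltac:(nra)) A /(_ ltac:(nra)) B C.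
have := dd_le x (u + v) h0 => D.
rewrite -(ler_pM2l t0); nra.
Qed.

Let dd0 x : dd x 0 = 0.
Proof.
apply/eqP; rewrite eq_le.
have := dd_le x 0 ltr01; have := dd_ge x 0 ltr01.
by rewrite scaler0 subr0 addr0 !mul1r subrr => -> ->.
Qed.

(** Subadditivity gives one inequality. For the other, [t * (dd x v + dd x (- v))] is at most the
    second difference along [t v], which is [o(t)]. Oddness then turns the sublinear [dd x] into a
    linear map. *)
Let ddN x v : dd x (- v) = - dd x v.
Proof.
apply/eqP; rewrite eq_le; apply/andP; split; last first.
  by have := ddD_le x v (- v); rewrite subrr dd0; lra.
apply: (@ler_add_epsM _ _ _ `|v|) => // e e0; have [d d0 hd] := Fsmooth e0.
have [t t0 ht] := exists_small (normr_ge0 v) d0.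
have := hd x (t *: v); rewrite normrZ gtr0_norm // => /(_ ht).
have := dd_le x v t0; have := dd_le x (- v) t0; rewrite scalerN => A B C.
rewrite -(ler_pM2l t0); lra.
Qed.

Let ddD x u v : dd x (u + v) = dd x u + dd x v.
Proof.
apply/eqP; rewrite eq_le ddD_le /=.
by have := ddD_le x (u + v) (- v); rewrite addrK ddN; lra.
Qed.

Let ddZ_le x v s : 0 < s -> dd x (s *: v) <= s * dd x v.
Proof.
move=> s0; apply: (@ler_add_epsM _ _ _ (s * `|v|)); first by rewrite mulr_ge0 // ltW.
move=> e e0; have [d d0 hd] := dd_ub e0.
have [t t0 ht] := exists_small (normr_ge0 (s *: v)) d0.
rewrite normrZ gtr0_norm // mulrA in ht.
have := hd x v (t * s) (mulr_gt0 t0 s0) ht.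
have := dd_le x (s *: v) t0; rewrite scalerA => A B.
rewrite -(ler_pM2l t0); lra.
Qed.

Let ddZ x v a : dd x (a *: v) = a * dd x v.
Proof.
have pos s w : 0 < s -> dd x (s *: w) = s * dd x w.
  move=> s0; apply/eqP; rewrite eq_le ddZ_le //=.
  have si : 0 < s^-1 by rewrite invr_gt0.
  have := ddZ_le x (s *: w) si; rewrite scalerA mulVf ?gt_eqF // scale1r.
  by rewrite -ler_pdivrMl ?invr_gt0 // invrK.
have [a0|a0|->] := ltgtP a 0; last by rewrite scale0r dd0 mul0r.
  rewrite -[a]opprK scaleNr ddN pos ?oppr_gt0 //; lra.
exact: pos.
Qed.

Let grad x := \row_i dd x (delta_mx ord0 i).

Let dd_dotv x v : dd x v = dotv (grad x) v.
Proof.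
have -> : dd x v = dd x (\sum_i v ord0 i *: delta_mx ord0 i).
  by rewrite -row_sum_delta.
rewrite (big_morph (dd x) (ddD x) (dd0 x)); apply: eq_bigr => i _.
by rewrite mxE ddZ mulrC.
Qed.

Let dd_linear x : linear (dd x).
Proof. by move=> a u v; rewrite ddD ddZ. Qed.

Let ddM x := GRing.isLinear.Build _ _ _ _ _ (dd_linear x).
Let ddL x : {linear 'rV[R]_n -> R} := HB.pack (dd x) (ddM x).

Let dd_continuous x : continuous (dd x).
Proof.
by rewrite (_ : dd x = dotv (grad x)) ?funeqE //; exact: dotv_continuous.
Qed.

Let diffF x : differentiable F x /\ 'd F x = dd x :> ('rV[R]_n -> R).
Proof.
apply: (@differentiable_of_remainder _ _ _ _ (ddL x)); first exact: dd_continuous.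
move=> e e0; have [d d0 hd] := dd_ub e0; near=> h.
have hlt : 1 * `|h| < d.
  rewrite mul1r; near: h.
  by apply: (@cvgr0_norm_lt _ _ _ (nbhs (0 : 'rV[R]_n)) _ id) => //; exact: cvg_id.
have := hd x h 1 ltr01 hlt; have := dd_le x h ltr01.
rewrite scale1r !mul1r ler_norml -[ddL x h]/(dd x h) => A B.
have := mulr_ge0 (ltW e0) (normr_ge0 h) => C; apply/andP; split; lra.
Unshelve. all: by end_near. Qed.

Lemma convex_uniformly_smooth_differentiable x : differentiable F x.
Proof. by have [] := diffF x. Qed.

(** For one fixed small [t], the difference quotient at [y] is within [e / 2] of [dd y v] for all
    [y] at once, and this quotient is continuous in [y]. *)
Lemma convex_uniformly_smooth_C1 : C1_on setT F.
Proof.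
split=> [x _|v]; first exact: convex_uniformly_smooth_differentiable.
have -> : (fun x => 'd F x v) = (fun x => dd x v).
  by apply/funext => y; have [_ ->] := diffF y.
apply: continuous_subspaceT => x.
have Fcts y : {for y, continuous F}.
  exact/differentiable_continuous/convex_uniformly_smooth_differentiable.
apply/(@cvgrPdist_le _ _ _ (nbhs x)) => e e0 /=.
pose e1 := e / (2 * (`|v| + 1)).
have e10 : 0 < e1 by rewrite divr_gt0 // mulr_gt0 // ltr_wpDl.
have [d d0 hd] := dd_ub e10; have [t t0 ht] := exists_small (normr_ge0 v) d0.
have et0 : 0 < e * t / 4 by rewrite divr_gt0 // mulr_gt0.
have nA : \forall y \near x, `|F x - F y| <= e * t / 4.
  by move/(@cvgrPdist_le _ _ _ (nbhs x)) : (Fcts x); exact.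
have nB : \forall y \near x, `|F (x + t *: v) - F (y + t *: v)| <= e * t / 4.
  have : (fun y => F (y + t *: v)) @ x --> F (x + t *: v).
    apply: continuous_comp; last exact: Fcts.
    by apply: (@cvgD _ _ _ (nbhs x) _ id (cst _)); [exact: cvg_id|exact: cvg_cst].
  by move=> /(@cvgrPdist_le _ _ _ (nbhs x)); exact.
apply: (@filterS2 _ (nbhs x) _ _ _ _ _ nA nB) => y A B.
have e1v : e1 * `|v| <= e / 2.
  by rewrite /e1 mulrAC ler_pdivrMr ?mulr_gt0 ?ltr_wpDl //; lra.
have e1vt : e1 * (t * `|v|) <= t * (e / 2) by rewrite mulrCA ler_wpM2l // ltW.
have := hd x v t t0 ht; have := hd y v t t0 ht.
have := dd_le x v t0; have := dd_le y v t0.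
move: A B; rewrite !ler_norml => /andP[A1 A2] /andP[B1 B2] C D G H.
by apply/andP; split; rewrite -(ler_pM2l t0); lra.
Qed.

End convex_uniformly_smooth.

(** A jet [((y, f), g)] consists of a base point, a value and a slope. *)
Definition affine_jet (R : realType) (n : nat)
    (i : 'rV[R]_n * R * 'rV[R]_n) (x : 'rV[R]_n) : R :=
  i.1.2 + dotv i.2 (x - i.1.1).

(** * The largest convex function below a family of parabolas *)

Section envelope.
Context {R : realType} {n : nat}.
Implicit Types (x y h v : 'rV[R]_n) (i j : 'rV[R]_n * R * 'rV[R]_n).
Variables (D : set ('rV[R]_n * R * 'rV[R]_n)) (L : set ('rV[R]_n -> R)).
Hypotheses (D0 : D !=set0) (L0 : L !=set0).
Hypothesis Lconvex : forall l, L l -> convex_fun l.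

(** [p] is the pair [(eta, C)]. With [dotv] in the quadratic term, the second difference along [h]
    is exactly [2 C * dotv h h]. *)
Let parab i (p : R * R) x : R :=
  affine_jet i x + p.1 + p.2 * dotv (x - i.1.1) (x - i.1.1).

Let admissible (p : R * R) : Prop :=
  [/\ 0 <= p.1, 0 <= p.2 & forall l i x, L l -> D i -> l x <= parab i p x].

Variable K : R.
Hypothesis K0 : 0 <= K.
Hypothesis L_global : forall l i x, L l -> D i ->
  l x <= affine_jet i x + K * `|x - i.1.1|.
Hypothesis L_local : forall e : R, 0 < e -> exists2 d : R, 0 < d &
  forall l i x, L l -> D i -> `|x - i.1.1| < d ->
  l x <= affine_jet i x + e * `|x - i.1.1|.

(* The parabola [e r / 2 + e t^2 / (2 r)] dominates [e t] by AM-GM and touches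
   it at [t = r]; the term [K t^2 / d] takes over where [t >= d]. *)
Let admissible_small (e : R) : 0 < e -> exists2 d : R, 0 < d &
  forall r, 0 < r -> r < d ->
  exists2 p, admissible p & p.1 + p.2 * (n%:R * r ^+ 2) <= e * r.
Proof.
move=> e0; pose n1 : R := n%:R + 1.
have n0 : 0 <= n%:R :> R by [].
have n10 : 0 < n1 by rewrite /n1; lra.
pose e1 := e / n1; have e10 : 0 < e1 by rewrite divr_gt0.
have e1E : e1 * n1 = e by rewrite divfK ?gt_eqF.
have [d d0 hd] := L_local e10.
pose C := K / d; have C0 : 0 <= C by rewrite divr_ge0 // ltW.
have Cd : C * d = K by rewrite divfK ?gt_eqF.
pose d1 := e1 / (2 * (n1 * C + 1)).
have nC : 0 < n1 * C + 1 by nra.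
have d1E : d1 * (2 * (n1 * C + 1)) = e1 by rewrite divfK // gt_eqF // mulr_gt0.
have d10 : 0 < d1 by rewrite divr_gt0 // mulr_gt0.
exists d1 => // r r0 rd1.
pose c := e1 / (2 * r); have c0 : 0 < c by rewrite divr_gt0 // mulr_gt0.
have cE : c * (2 * r) = e1 by rewrite divfK // gt_eqF // mulr_gt0.
exists (e1 * r / 2, c + C); last first.
  rewrite /= expr2.
  have -> : e1 * r / 2 + (c + C) * (n%:R * (r * r))
      = r * (e1 / 2 + n%:R * (c * (2 * r)) / 2 + n%:R * C * r) by field.
  rewrite cE mulrC ler_pM2r // -e1E /n1.
  have A : n%:R * C * r <= n%:R * C * d1 by apply: ler_wpM2l; [exact: mulr_ge0|exact: ltW].
  have B : 0 <= C * d1 by rewrite mulr_ge0 // ltW.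
  have E : 0 <= n%:R * e1 by rewrite mulr_ge0 // ltW.
  by move: d1E; rewrite /n1; lra.
split=> /=; first by rewrite divr_ge0 // mulr_ge0 // ltW.
  by rewrite addr_ge0 // ltW.
move=> l i x lL iD; rewrite /parab /=.
have q := sqr_norm_le_dotv (x - i.1.1).
set t := `|x - i.1.1| in q *; have t0 : 0 <= t by exact: normr_ge0.
set s := dotv _ _ in q *.
have amgm : e1 * t <= e1 * r / 2 + c * t ^+ 2.
  have : 0 <= c * (t - r) ^+ 2 by rewrite mulr_ge0 ?sqr_ge0 // ltW.
  by rewrite -cE; lra.
have cs : c * t ^+ 2 <= c * s by rewrite ler_wpM2l // ltW.
have Cs : C * t ^+ 2 <= C * s by rewrite ler_wpM2l.
have [td|dt] := ltP t d.
  have := hd l i x lL iD td; rewrite -/t.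
  have : 0 <= C * t ^+ 2 by rewrite mulr_ge0 // sqr_ge0.
  lra.
have := L_global x lL iD; rewrite -/t.
have : K * t <= C * t ^+ 2.
  by rewrite -Cd expr2 mulrA ler_wpM2r // ler_wpM2l.
have : 0 <= e1 * t by rewrite mulr_ge0 // ltW.
lra.
Qed.

Let minorant (c : 'rV[R]_n -> R) : Prop := convex_fun c /\
  forall i p x, D i -> admissible p -> c x <= parab i p x.

Let F x := sup [set c x | c in minorant].

Let L_minorant l : L l -> minorant l.
Proof. by move=> lL; split; [exact: Lconvex|move=> i p x iD [_ _]; exact]. Qed.

(** The supremum is finite: members of [L] are minorants, and a single jet with a single admissible
    pair bounds every minorant from above. *)
Let minorants_sup x : has_sup [set c x | c in minorant].
Proof.
have [l lL] := L0; have [i iD] := D0; split.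
  by exists (l x), l => //; exact: L_minorant.
have [d d0 /(_ (d / 2))[||p hp _]] := admissible_small ltr01; [lra|lra|].
by exists (parab i p x) => _ [c [_ hc] <-]; exact: hc.
Qed.

Let minorant_le c x : minorant c -> c x <= F x.
Proof.
by move=> hc; apply: ub_le_sup; [have [] := minorants_sup x|exists c].
Qed.

Let F_le i p x : D i -> admissible p -> F x <= parab i p x.
Proof.
move=> iD hp; apply: ge_sup; first by have [] := minorants_sup x.
by move=> _ [c [_ hc] <-]; exact: hc.
Qed.

Let F_convex : convex_fun F.
Proof.
move=> x y t t0 t1; apply: ge_sup.
  by have [] := minorants_sup (t *: x + (1 - t) *: y).
move=> _ [c hc <-]; apply: le_trans (hc.1 x y t t0 t1) _.
by rewrite lerD // ler_wpM2l ?subr_ge0 // minorant_le.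
Qed.

(* The symmetrised function is again a convex minorant, so it cannot exceed
   the largest one. *)
Let F_smooth : uniformly_smooth F.
Proof.
move=> e e0; have e20 : 0 < e / 2 by lra.
have [d d0 hd] := admissible_small e20; exists d => // x h hlt.
have [->|h0] := eqVneq h 0; first by rewrite addr0 subr0 normr0; lra.
have r0 : 0 < `|h| by rewrite normr_gt0.
have [p hp pr] := hd _ r0 hlt.
pose c z := (F (z + h) + F (z - h)) / 2 - e / 2 * `|h|.
suff /minorant_le : minorant c by move=> /(_ x); rewrite /c; lra.
split.
  move=> z w t t0 t1; rewrite /c.
  have -> : t *: z + (1 - t) *: w + h = t *: (z + h) + (1 - t) *: (w + h).
    by apply/rowP => k; rewrite !mxE; ring.
  have -> : t *: z + (1 - t) *: w - h = t *: (z - h) + (1 - t) *: (w - h).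
    by apply/rowP => k; rewrite !mxE; ring.
  have := F_convex (z + h) (w + h) t0 t1; have := F_convex (z - h) (w - h) t0 t1.
  lra.
move=> i q z iD hq; rewrite /c.
have parabE p' : parab i p' (z + h) + parab i p' (z - h)
    = 2 * parab i p' z + 2 * (p'.2 * dotv h h).
  rewrite /parab /affine_jet (addrAC z h) (addrAC z (- h)).
  rewrite !(dotvDl (z - _)) !(dotvDr _ (z - _)) !dotvNl !dotvNr.
  by rewrite (dotvC h (z - _)); ring.
have hh : dotv h h <= n%:R * `|h| ^+ 2.
  by rewrite expr2 (le_trans (ler_norm _)) // dotv_le_norm.
have hh0 := dotvv_ge0 h; have zz0 := dotvv_ge0 (z - i.1.1).
have [p10 p20 _] := hp; have [q10 q20 _] := hq.
have pb : p.2 * dotv h h <= p.2 * (n%:R * `|h| ^+ 2) by rewrite ler_wpM2l.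
(* The flatter of the two parabolas is averaged over [z + h] and [z - h]. If it is that of [q], the
   averaging costs at most [p.2 * dotv h h]. Otherwise the [p]-parabola has the smaller quadratic
   term at [z], and its excess [p.1 + p.2 * dotv h h] is at most [e / 2 * |h|]. *)
have [qp|pq] := leP q.2 p.2.
  have := F_le (z + h) iD hq; have := F_le (z - h) iD hq; have := parabE q.
  have : q.2 * dotv h h <= p.2 * dotv h h by rewrite ler_wpM2r.
  lra.
have := F_le (z + h) iD hp; have := F_le (z - h) iD hp; have := parabE p.
have : p.2 * dotv (z - i.1.1) (z - i.1.1) <= q.2 * dotv (z - i.1.1) (z - i.1.1).
  by rewrite ler_wpM2r // ltW.
rewrite {3 6}/parab; lra.
Qed.

(** At its base point a parabola has height [i.1.2 + p.1], and [p.1 <= r] for admissible pairs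
    chosen at scale [r]; let [r] tend to [0]. *)
Let F_pt i : D i -> F i.1.1 <= i.1.2.
Proof.
move=> iD; apply: (@ler_add_epsM _ _ _ 1) => // e e0; rewrite mulr1.
have [d d0 hd] := admissible_small ltr01.
pose r := Num.min (d / 2) e.
have r0 : 0 < r by rewrite lt_min e0 andbT; lra.
have rd : r < d by rewrite gt_min; apply/orP; left; lra.
have re : r <= e by rewrite ge_min lexx orbT.
have [p hp] := hd _ r0 rd; have := F_le i.1.1 iD hp; have [p10 p20 _] := hp.
rewrite /parab /affine_jet subrr !dotv0r mulr0 !addr0 mul1r => A B.
have : 0 <= p.2 * (n%:R * r ^+ 2) by rewrite mulr_ge0 // mulr_ge0 // sqr_ge0.
lra.
Qed.

Lemma convex_envelope : exists F : 'rV[R]_n -> R,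
  [/\ convex_fun F, uniformly_smooth F, forall l x, L l -> l x <= F x
    & forall i, D i -> F i.1.1 <= i.1.2].
Proof.
exists F; split=> //; move=> l x lL; exact/minorant_le/L_minorant.
Qed.

End envelope.

Lemma cvg_dotv (R : realType) (n : nat) (T : Type) (F : set_system T)
    (f g : T -> 'rV[R]_n) (a b : 'rV[R]_n) : Filter F ->
  f @ F --> a -> g @ F --> b -> dotv (f t) (g t) @[t --> F] --> dotv a b.
Proof.
move=> FF fa gb; apply: cvg_big => [|i _]; first exact: add_continuous.
apply: cvgM; first exact: (cvg_comp _ _ fa (@coord_continuous R 1 n ord0 i a)).
exact: (cvg_comp _ _ gb (@coord_continuous R 1 n ord0 i b)).
Qed.

Lemma convex_affine_jet (R : realType) (n : nat)
    (i : 'rV[R]_n * R * 'rV[R]_n) : convex_fun (affine_jet i).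
Proof. by move=> x y t _ _; rewrite /affine_jet !dotvBr dotvDr !dotvZr; lra. Qed.

(** * Convex C^1 extension of a compact set of jets *)

Section jet_extension.
Context {R : realType} {n : nat}.
Implicit Types (x v : 'rV[R]_n) (i j : 'rV[R]_n * R * 'rV[R]_n).
Variable D : set ('rV[R]_n * R * 'rV[R]_n).
Hypotheses (cD : compact D) (D0 : D !=set0).
Hypothesis D_le : forall i j, D i -> D j -> affine_jet j i.1.1 <= i.1.2.
Hypothesis D_eq : forall i j, D i -> D j ->
  affine_jet j i.1.1 = i.1.2 -> j.2 = i.2.

Let D_bounded : exists2 M : R, 0 < M & forall i, D i ->
  [/\ `|i.1.1| <= M, `|i.1.2| <= M & `|i.2| <= M].
Proof.
have /pinfty_ex_gt0[M M0 hM] := compact_bounded cD.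
exists M => // -[[y f] g] /hM /=; rewrite !prod_normE /= !ge_max.
by move=> /andP[/andP[-> ->] ->].
Qed.

Let J := ('rV[R]_n * R * 'rV[R]_n)%type.

Let pt_continuous : continuous (fun i : J => i.1.1).
Proof. by move=> [[y f] g]; apply: cvg_comp; exact: cvg_fst. Qed.

Let val_continuous : continuous (fun i : J => i.1.2).
Proof.
by move=> [[y f] g]; apply: cvg_comp; [exact: cvg_fst|exact: cvg_snd].
Qed.

Let slope_continuous : continuous (fun i : J => i.2).
Proof. by move=> [[y f] g]; exact: cvg_snd. Qed.

Let comp_fst (T : topologicalType) (f : J -> T) : continuous f ->
  continuous (fun p : J * J => f p.1).
Proof.
by move=> cf [i j]; apply: (cvg_comp _ f _ (cf i)); exact: cvg_fst.
Qed.

Let comp_snd (T : topologicalType) (f : J -> T) : continuous f ->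
  continuous (fun p : J * J => f p.2).
Proof.
by move=> cf [i j]; apply: (cvg_comp _ f _ (cf j)); exact: cvg_snd.
Qed.

Let gap_continuous :
  continuous (fun p : J * J => p.1.1.2 - affine_jet p.2 p.1.1.1).
Proof.
move=> p; apply: cvgB; first exact: (comp_fst val_continuous).
apply: cvgD; first exact: (comp_snd val_continuous).
apply: cvg_dotv; first exact: (comp_snd slope_continuous).
apply: cvgB; first exact: (comp_fst pt_continuous).
exact: (comp_snd pt_continuous).
Qed.

Let slope_dist_continuous : continuous (fun p : J * J => `|p.2.2 - p.1.2|).
Proof.
move=> p; apply: cvg_norm; apply: cvgB; first exact: (comp_snd slope_continuous).
exact: (comp_fst slope_continuous).
Qed.

(* Jets whose slopes differ by at least [e] form a compact set of pairs on which
   the gap [f_i - a_j(y_i)] is positive. *)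
Let gap_pos (e : R) : 0 < e -> exists2 eta : R, 0 < eta & forall i j, D i -> D j ->
  e <= `|j.2 - i.2| -> eta <= i.1.2 - affine_jet j i.1.1.
Proof.
move=> e0.
pose S := (D `*` D) `&`
  (fun p : J * J => `|p.2.2 - p.1.2|) @^-1` [set r | e <= r].
have cS : compact S.
  apply: compact_closedI; first exact: compact_setX.
  by apply: preimage_closed => [p _|]; [exact: slope_dist_continuous|exact: closed_ge].
have [S0|/set0P/negP/negPn/eqP S0] := pselect (S !=set0); last first.
  by exists 1 => // i j iD jD ij; have : S (i, j) by []; rewrite S0.
have [[i j] /set_mem[[/= iD jD] /= ij] min] := compact_EVT_min S0 cS
  (continuous_subspaceT gap_continuous).
exists (i.1.2 - affine_jet j i.1.1); last first.
  by move=> i' j' iD' jD' ij'; apply: (min (i', j')); rewrite inE.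
rewrite subr_gt0 lt_neqAle D_le // andbT; apply/eqP => /(D_eq iD jD) E.
by move: ij; rewrite E subrr normr0 leNgt e0.
Qed.

(** The envelope is taken over the affine functions of all jets together with a coercive cone
    [kappa]. The last two conclusions force [F] to take the prescribed value at each base point. *)
Lemma convex_C1_extension : exists (F : 'rV[R]_n -> R) (B : R),
  [/\ convex_fun F, C1_on setT F, forall x, `|x| - B <= F x,
      forall i, D i -> F i.1.1 <= i.1.2
    & forall i x, D i -> affine_jet i x <= F x].
Proof.
have [M M0 hM] := D_bounded; pose nM := n%:R * M.
have n0 : 0 <= n%:R :> R by [].
have nM0 : 0 <= nM by rewrite mulr_ge0 // ltW.
(* This [B] puts [kappa] at least [1] below the prescribed value at every base point. *)
pose B := 2 * M + 1; pose kappa x := `|x| - B.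
pose L := [set l | l = kappa \/ exists2 j, D j & l = affine_jet j].
have dot_le i v : D i -> `|dotv i.2 v| <= nM * `|v|.
  move=> /hM[_ _ h]; apply: le_trans (dotv_le_norm _ _) _.
  by rewrite -mulrA ler_wpM2l // ler_wpM2r.
have kappa_le i x : D i ->
    kappa x <= affine_jet i x - 1 + (1 + nM) * `|x - i.1.1|.
  move=> iD; have [A1 A2 _] := hM _ iD.
  have := dot_le i (x - i.1.1) iD; move: A2; rewrite !ler_norml.
  move=> /andP[A2 _] /andP[A3 _].
  have := ler_normD (x - i.1.1) i.1.1; rewrite subrK.
  by rewrite /kappa /B /affine_jet; lra.
(* Expanding jet [j] around the base point of [i] separates the gap between the two from the
   difference of their slopes. *)
have jetE i j x : affine_jet j x = affine_jet i x
    - (i.1.2 - affine_jet j i.1.1) + dotv (j.2 - i.2) (x - i.1.1).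
  by rewrite /affine_jet dotvBl !dotvBr; ring.
have dot2 i j v : D i -> D j -> dotv (j.2 - i.2) v <= 2 * nM * `|v|.
  move=> iD jD; have := dot_le i v iD; have := dot_le j v jD.
  by rewrite !ler_norml dotvBl => /andP[_ ?] /andP[? _]; lra.
have gap0 i j : D i -> D j -> 0 <= i.1.2 - affine_jet j i.1.1.
  by move=> iD jD; rewrite subr_ge0 D_le.
have [|||||F [F1 F2 F3 F4]] := @convex_envelope R n D L D0 _ _ (1 + 2 * nM) _ _ _.
- by exists kappa; left.
- move=> _ [->|[j _ ->]]; last exact: convex_affine_jet.
  move=> x y t t0 t1; have := ler_normD (t *: x) ((1 - t) *: y).
  by rewrite !normrZ !ger0_norm ?subr_ge0 // /kappa; lra.
- by lra.
- move=> _ i x [->|[j jD ->]] iD; have xi := normr_ge0 (x - i.1.1).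
    have := kappa_le i x iD; have := mulr_ge0 nM0 xi; lra.
  by rewrite (jetE i); have := dot2 i j (x - i.1.1) iD jD; have := gap0 i j iD jD; lra.
(* The factor [n + 1] compensates for the [n] lost in [dotv_le_norm]. *)
- move=> e e0; pose e1 := e / (n%:R + 1).
  have e10 : 0 < e1 by rewrite divr_gt0 // ltr_wpDl.
  have e1E : e1 * (n%:R + 1) = e by rewrite divfK // gt_eqF // ltr_wpDl.
  have [eta eta0 hgap] := gap_pos e10.
  (* Within distance [d] the linear terms, of slope at most [1 + 2 * nM], cannot exceed the gap [1]
     of [kappa] or the gap [eta] of jets with distant slopes. *)
  pose d := Num.min 1 eta / (1 + 2 * nM).
  have k0 : 0 < 1 + 2 * nM by lra.
  exists d; first by rewrite divr_gt0 // lt_min ltr01.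
  move=> l i x lL iD; rewrite ltr_pdivlMr // lt_min => /andP[d1 deta].
  have xi := normr_ge0 (x - i.1.1); have nxi := mulr_ge0 nM0 xi.
  have exi := mulr_ge0 (ltW e0) xi.
  case: lL => [->|[j jD ->]]; first by have := kappa_le i x iD; lra.
  rewrite (jetE i); have := gap0 i j iD jD.
  (* Distant slopes are paid for by the gap [eta]; for close slopes the linear term is itself at
     most [e * |x - i.1.1|]. *)
  have [/(hgap _ _ iD jD)|/ltW small] := leP e1 `|j.2 - i.2|.
    by have := dot2 i j (x - i.1.1) iD jD; lra.
  have : dotv (j.2 - i.2) (x - i.1.1) <= n%:R * (e1 * `|x - i.1.1|).
    apply: le_trans (ler_norm _) _; apply: le_trans (dotv_le_norm _ _) _.
    by rewrite ler_wpM2l // ler_wpM2r.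
  have := mulr_ge0 (ltW e10) xi; rewrite -e1E; lra.
exists F, B; split=> //; first exact: convex_uniformly_smooth_C1.
  by move=> x; apply: (F3 kappa); left.
by move=> i x iD; apply: F3; right; exists i.
Qed.

End jet_extension.

(** * One-sided difference quotients and supporting hyperplanes *)

Lemma cvg_right_quotient (R : realType) (V W : normedModType R) (f : V -> W)
    (x v : V) : differentiable f x ->
  t^-1 *: (f (x + t *: v) - f x) @[t --> (0 : R)^'+] --> 'd f x v.
Proof.
move=> df; rewrite -(deriveE v df); apply: cvg_dnbhs_at_right.
have -> : (fun t => t^-1 *: (f (x + t *: v) - f x))
    = (fun h => h^-1 *: ((f \o shift x) (h *: v) - f x)).
  by apply/funext => h /=; rewrite (addrC x).
exact: diff_derivable.
Qed.

Lemma convex_diff_le (R : realType) (V : normedModType R) (F : V -> R) (x y : V) :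
  convex_fun F -> differentiable F x -> 'd F x (y - x) <= F y - F x.
Proof.
move=> cF dF; have /cvgr_to_le := @cvg_right_quotient _ _ _ _ _ (y - x) dF.
apply; near=> t; rewrite [_ *: _]/(_ * _) ler_pdivrMl //.
have -> : x + t *: (y - x) = t *: y + (1 - t) *: x.
  by rewrite scalerBr scalerBl scale1r addrCA.
have t0 : 0 <= t by [].
have t1 : t <= 1 by near: t; exact: nbhs_right_ltW.
by have := cF y x t t0 t1; lra.
Unshelve. all: by end_near. Qed.

(** Along a curve in [S] the function [dotv nu (gamma t - p)] is maximal at [0]; the two directions
    [s = 1] and [s = -1] give opposite inequalities for its derivative. *)
Lemma tangent_space_supporting (R : realType) (n : nat) (S : set 'rV[R]_n)
    (p nu w : 'rV[R]_n) : (forall x, S x -> dotv nu (x - p) <= 0) ->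
  tangent_space S p w -> dotv nu w = 0.
Proof.
move=> sup [e [gamma [e0 [dgamma _] gS g0 gw]]].
have d0 : differentiable gamma 0.
  by apply: dgamma; rewrite /= in_itv /= oppr_lt0 e0.
have one_side (s : R) : `|s| = 1 -> dotv nu (s *: w) <= 0.
  move=> s1; have := @cvg_right_quotient _ _ _ _ _ s d0.
  rewrite (_ : 'd gamma 0 s = s *: w); last first.
    by rewrite -gw derive1E' // -linearZ /= [s *: 1]mulr1.
  move=> /(cvg_dotv _ (@cvg_cst _ nu _ _ _)) /cvgr_to_le; apply; near=> t.
  rewrite dotvZr pmulr_rle0 ?invr_gt0 // add0r g0; apply/sup/gS.
  have : `|t *: s| < e by rewrite normrZ s1 mulr1 gtr0_norm.
  by rewrite in_itv /= ltr_norml.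
have := one_side 1 (normr1 _); have := one_side (-1) _.
rewrite normrN normr1 scaleN1r scale1r dotvNr => /(_ erefl) A B.
by apply/eqP; rewrite eq_le; apply/andP; split; lra.
Unshelve. all: by end_near. Qed.

(** * Sublevel sets of coercive convex C^1 functions *)

Section sublevel_body.
Context {R : realType} {n : nat}.
Variables (F : 'rV[R]_n -> R) (B : R).
Hypotheses (Fconvex : convex_fun F) (FC1 : C1_on setT F).
Hypotheses (Fcoercive : forall x, `|x| - B <= F x) (F0 : F 0 < 0).

Let V : set 'rV[R]_n := [set x | F x <= 0].

Let F_continuous : continuous F.
Proof. by move=> x; apply/differentiable_continuous/FC1.1. Qed.

Let V_closed : closed V.
Proof.
apply: (@preimage_closed _ _ F [set r | r <= 0]) => [x _|].
  exact: F_continuous.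
exact: closed_le.
Qed.

Let F_open_gt (a : R) : open [set x | a < F x].
Proof.
by apply: (@open_comp _ _ F [set r | a < r]) => [x _|]; [exact: F_continuous|exact: open_gt].
Qed.

Let neg_interior x : F x < 0 -> V° x.
Proof.
move=> Fx; apply: (filterS (P := [set y | F y < 0])); first by move=> y /ltW.
have N0 : nbhs (F x) [set r | r < 0].
  by apply: open_nbhs_nbhs; split=> //; exact: open_lt.
exact: (@F_continuous x _ N0).
Qed.

(** If [F x = 0] at an interior point, then [(1 + t) x] is still in [V] for small [t > 0]. But [x]
    lies strictly between that point and [0], where [F] is negative, so convexity gives
    [F x < 0]. *)
Let interior_neg x : V° x -> F x < 0.
Proof.
move=> Vx; rewrite lt_neqAle; apply/andP; split; last exact: (interior_subset Vx).
apply/eqP => Fx.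
have : (fun t : R => (1 + t) *: x) @ (0 : R)^'+ --> x.
  apply: cvg_at_right_filter; rewrite -[X in _ --> X]scale1r -[X in X *: _]addr0.
  by apply: cvgZr_tmp; apply: cvgD; [exact: cvg_cst|exact: cvg_id].
move=> /(_ V Vx) near_V; near (0 : R)^'+ => t.
have t0 : 0 < t by [].
have : V ((1 + t) *: x) by near: t.
have t1 : 0 < 1 + t by lra.
rewrite /V /= => FV; have := @Fconvex ((1 + t) *: x) 0 (1 + t)^-1.
rewrite scaler0 addr0 scalerA mulVf ?gt_eqF // scale1r Fx.
have s0 : 0 < (1 + t)^-1 by rewrite invr_gt0.
have s1 : (1 + t)^-1 < 1 by rewrite invf_lt1 //; lra.
have A : (1 + t)^-1 * F ((1 + t) *: x) <= 0 by rewrite pmulr_rle0.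
have C : (1 - (1 + t)^-1) * F 0 < 0 by rewrite pmulr_rlt0 // subr_gt0.
by move=> /(_ (ltW s0) (ltW s1)); lra.
Unshelve. all: by end_near. Qed.

Lemma sublevel_boundary : boundary V = [set x | F x = 0].
Proof.
rewrite /boundary -(proj1 (closure_id V) V_closed) eqEsubset; split => x /=.
  move=> [Vx nVx]; apply/eqP; rewrite eq_le Vx /= leNgt; apply/negP => /neg_interior.
  exact: nVx.
move=> Fx; split; first by rewrite /V /= Fx.
by move=> /interior_neg; rewrite Fx ltxx.
Qed.

Lemma sublevel_interior0 : V° 0.
Proof. exact: neg_interior. Qed.

Lemma sublevel_C1_convex_body : C1_convex_body V.
Proof.
split; last first.
  (* [F] itself is the defining function. Where [F 0 < F x] its differential is nonzero, since by
     convexity ['d F x (0 - x) <= F 0 - F x < 0]. *)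
  move=> p; rewrite sublevel_boundary /= => Fp; exists [set x | F 0 < F x], F.
  split; first exact: F_open_gt.
  - by rewrite /= Fp.
  - split=> [x _|v]; first exact: FC1.1.
    exact: (continuous_subspaceW _ (FC1.2 v)).
  - move=> x /= Fx; exists (0 - x); rewrite lt_eqF //.
    by have := convex_diff_le 0 Fconvex (FC1.1 x I); lra.
  - by apply/seteqP; split => x /= [].
split; last by exists 0; exact: sublevel_interior0.
- apply: bounded_closed_compact => //; exists B; split; first exact: num_real.
  by move=> M BM x; rewrite /V /= => Fx; have := Fcoercive x; lra.
- move=> x y t; rewrite !inE /V /= => Fx Fy.
  apply: le_trans (@Fconvex x y t%:num _ _) _; [exact: ge0|exact: le1|].
  have t0 : 0 <= t%:num by exact: ge0.
  have t1 : t%:num <= 1 by exact: le1.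
  nra.
Qed.

End sublevel_body.

(** * Sufficiency: a body with prescribed normals *)

Lemma C1_convex_body_of_normals (R : realType) (n : nat) (K : set 'rV[R]_n)
    (N : 'rV[R]_n -> 'rV[R]_n) :
  compact K -> {within K, continuous N} ->
  (forall y, K y -> 0 < dotv (N y) y) ->
  (forall x y, K x -> K y -> dotv (N y) (x - y) <= 0) ->
  (forall x y, K x -> K y -> dotv (N y) (x - y) = 0 -> N x = N y) ->
  exists V : set 'rV[R]_n, [/\ C1_convex_body V, V° 0, K `<=` boundary V
    & forall y, K y -> outward_normal V y (N y)].
Proof.
move=> cK cN Npos Nle Neq.
have id_cont : {within K, continuous (@id 'rV[R]_n)}.
  by apply: continuous_subspaceT => x; exact: cvg_id.
(* Half the minimum of [dotv (N y) y] over [K], or [1] if [K] is empty: the value [-c] then lies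
   strictly above the value at the origin of every affine function prescribed on [K]. *)
have [c c0 cle] : exists2 c : R, 0 < c & forall y, K y -> c < dotv (N y) y.
  have [K0|/set0P/negP/negPn/eqP K0] := pselect (K !=set0); last first.
    by exists 1 => // y; rewrite K0.
  have cdot : {within K, continuous (fun y => dotv (N y) y)}.
    by move=> x; exact: (cvg_dotv _ (cN x) (id_cont x)).
  have [y /set_mem Ky min] := compact_EVT_min K0 cK cdot.
  have := Npos y Ky => y0; exists (dotv (N y) y / 2); first by lra.
  by move=> z Kz; have := min z (mem_set Kz); lra.
pose jet y : 'rV[R]_n * R * 'rV[R]_n := (y, 0, N y).
pose D := [set ((0 : 'rV[R]_n), - c, (0 : 'rV[R]_n))] `|` jet @` K.
have cD : compact D.
  apply: compactU; first exact: compact_set1.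
  apply: continuous_compact => // x.
  have zero_cont : {within K, continuous (fun=> 0 : R)}.
    by apply: continuous_subspaceT; exact: cst_continuous.
  exact: (cvg_pair (cvg_pair (id_cont x) (zero_cont x)) (cN x)).
have dot0 y : dotv (0 : 'rV[R]_n) y = 0 by rewrite dotvC dotv0r.
have D0 : D !=set0 by exists (0, - c, 0); left.
have [||F [B [F1 F2 F3 F4 F5]]] := @convex_C1_extension R n D cD D0.
- move=> _ _ [->|[x Kx <-]] [->|[y Ky <-]]; rewrite /affine_jet /= ?dot0 ?addr0 //.
  + by rewrite sub0r dotvNr; have := cle y Ky; lra.
  + by rewrite oppr_le0 ltW.
  + by rewrite add0r Nle.
(* Between the origin and a point of [K] the gap is strict, so equality has content only for two
   points of [K], where the third condition applies. *)
- move=> _ _ [->|[x Kx <-]] [->|[y Ky <-]]; rewrite /affine_jet /= ?dot0 ?addr0 //.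
  + by rewrite sub0r dotvNr add0r => E; exfalso; have := cle y Ky; lra.
  + by move=> E; exfalso; lra.
  + by rewrite add0r => /(Neq _ _ Kx Ky) ->.
have F0 : F 0 < 0 by have := F4 (0, - c, 0) (or_introl erefl); rewrite /=; lra.
have jetF y x : K y -> dotv (N y) (x - y) <= F x.
  by move=> Ky; have := F5 (jet y) x (or_intror (ex_intro2 _ _ y Ky erefl));
    rewrite /affine_jet /= add0r.
have FK y : K y -> F y = 0.
  move=> Ky; apply/eqP; rewrite eq_le (F4 (jet y)); last by right; exists y.
  by have := jetF y y Ky; rewrite subrr dotv0r.
have bdE := sublevel_boundary F1 F2 F0.
exists [set x | F x <= 0]; split.
- exact: (sublevel_C1_convex_body F1 F2 F3 F0).
- exact: (sublevel_interior0 F2 F0).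
- by move=> y Ky; rewrite bdE /= FK.
- move=> y Ky; split=> [w|].
    apply: tangent_space_supporting => x; rewrite bdE /= => Fx.
    by have := jetF y x Ky; rewrite Fx.
  (* The affine function at [y] gives [F (y + t N y) >= t * dotv (N y) (N y) > 0]. *)
  near=> t => /= Ft; have := jetF y (y + t *: N y) Ky.
  rewrite addrAC subrr add0r dotvZr => h.
  have N0 : N y != 0.
    by apply/eqP => N0; have := Npos y Ky; rewrite N0 dot0 ltxx.
  have t0 : 0 < t by [].
  by have := mulr_gt0 t0 (dotvv_gt0 N0); lra.
Unshelve. all: by end_near. Qed.

(** * Mean values along segments and implicit curves in a zero set *)

Lemma mean_value_segment (R : realType) (E : normedModType R) (g : E -> R)
    (p v : E) :
  (forall t : R, t \in `[0, 1] -> differentiable g (p + t *: v)) ->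
  exists2 t : R, t \in `[0, 1] & g (p + v) - g p = 'd g (p + t *: v) v.
Proof.
move=> dg; pose f (t : R) := g (p + t *: v).
have quotE (t : R) : (fun h : R => h^-1 *: ((f \o shift t) (h *: (1 : R)) - f t))
    = (fun h : R => h^-1 *: ((g \o shift (p + t *: v)) (h *: v) - g (p + t *: v))).
  apply/funext => h /=; rewrite /f; congr (_ *: (g _ - _)).
  by rewrite [h *: 1]mulr1 scalerDl addrCA.
have fd (t : R) : t \in `[0, 1] -> is_derive t (1 : R) f ('d g (p + t *: v) v).
  move=> t01; have dgt := dg t t01; apply: DeriveDef.
    by rewrite /derivable quotE; exact: diff_derivable.
  by rewrite /derive quotE -deriveE.
have fd_oo (t : R) : t \in `]0, 1[ -> is_derive t (1 : R) f ('d g (p + t *: v) v).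
  by move=> /subset_itv_oo_cc; exact: fd.
have fc : {within `[0 : R, 1], continuous f}.
  by apply: derivable_within_continuous => t /fd[].
have [c c01] := @MVT_segment R f (fun t : R => 'd g (p + t *: v) v) 0 1 ler01 fd_oo fc.
by rewrite /f scale0r scale1r addr0 subr0 mulr1 => E1; exists c.
Qed.

Lemma differentiable_curve (R : realType) (V : normedModType R) (c : R -> V)
    (t : R) (z : V) :
  (forall e : R, 0 < e ->
    \forall h \near 0, `|c (t + h) - c t - h *: z| <= e * `|h|) ->
  differentiable c t /\ forall h, 'd c t h = h *: z.
Proof.
have lin : linear (fun h : R => h *: z).
  by move=> a h k; rewrite scalerDl scalerA.
pose lM := GRing.isLinear.Build _ _ _ _ _ lin.
pose l : {linear R -> V} := HB.pack (fun h : R => h *: z) lM.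
have lc : continuous l by exact: scalel_continuous.
by move=> /(differentiable_of_remainder lc)[dc ->].
Qed.

Section implicit_curve.
Context {R : realType} {E : normedModType R}.
Variables (U : set E) (g : E -> R) (p w u : E).
Hypotheses (oU : open U) (Up : U p) (gC1 : C1_on U g) (gp : g p = 0).
Hypotheses (gw : 'd g p w = 0) (gu : 'd g p u = 1).

Let P (t s : R) : E := p + (t *: w + s *: u).

Let diff_cvg v x : U x -> ('d g y v @[y --> x] --> ('d g x v : R)).
Proof.
move=> Ux; have := gC1.2 v; rewrite continuous_open_subspace // => h.
by apply: h; rewrite inE.
Qed.

(** At [p] the derivatives along [w] and [u] are [0] and [1], so continuity gives these bounds on a
    small box. They let the transversal direction dominate: [g] changes sign in [s], and the
    implicit slope is at most [1] in absolute value. *)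
Let box : exists2 r : R, 0 < r & forall t s, `|t| <= r -> `|s| <= r ->
  [/\ U (P t s), `|'d g (P t s) w| <= 1 / 4 & 1 / 2 <= 'd g (P t s) u].
Proof.
have q4 : 0 < 1 / 4 :> R by lra.
have q2 : 0 < 1 / 2 :> R by lra.
have nU : nbhs p U by apply: open_nbhs_nbhs.
have /cvgrPdist_le/(_ _ q4) nw := @diff_cvg w _ Up.
have /cvgrPdist_le/(_ _ q2) nu := @diff_cvg u _ Up.
have : nbhs p (U `&` [set y | `|'d g p w - 'd g y w| <= 1 / 4
    /\ `|'d g p u - 'd g y u| <= 1 / 2]) by apply: filterI => //; exact: filterI.
move=> /nbhs_ballP[d /= d0 hd].
have k0 : 0 < `|w| + `|u| + 1 by rewrite ltr_wpDl // addr_ge0.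
pose r := d / (`|w| + `|u| + 1).
have rE : r * (`|w| + `|u| + 1) = d by rewrite divfK // gt_eqF.
have r0 : 0 < r by rewrite divr_gt0.
exists r => // t s tr sr.
have /hd[UP []] : ball p d (P t s).
  rewrite -ball_normE /= /P opprD addNKr normrN.
  apply: le_lt_trans (ler_normD _ _) _; rewrite !normrZ.
  have := ler_wpM2r (normr_ge0 w) tr; have := ler_wpM2r (normr_ge0 u) sr.
  by lra.
rewrite gw gu sub0r normrN => A; rewrite ler_norml => /andP[_ B].
by split=> //; lra.
Qed.

(** For each [t] a zero [s t] comes from the intermediate value theorem. The mean value theorem
    makes any choice of zeros Lipschitz and expresses its increments by the ratio of the two
    derivatives. *)
Lemma implicit_curve : exists (e : R) (gamma : R -> E),
  [/\ 0 < e, C1_on `]-e, e[ gamma,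
      forall t, t \in `]-e, e[ -> U (gamma t) /\ g (gamma t) = 0,
      gamma 0 = p & derive1 gamma 0 = w].
Proof.
have [r r0 hr] := box.
have segP t s t' s' k : P t s + k *: (P t' s' - P t s)
    = P (t + k * (t' - t)) (s + k * (s' - s)).
  have -> : P t' s' - P t s = (t' - t) *: w + (s' - s) *: u.
    by rewrite /P opprD addrACA subrr add0r opprD addrACA -!scalerBl.
  by rewrite /P -addrA scalerDr !scalerA addrACA -!scalerDl.
(* The box is convex, so the intermediate point stays in it and inherits the bounds of [box]. *)
have mv t s t' s' : `|t| <= r -> `|s| <= r -> `|t'| <= r -> `|s'| <= r ->
    exists2 k, 0 <= k <= 1 &
    let x := P (t + k * (t' - t)) (s + k * (s' - s)) in
    [/\ `|'d g x w| <= 1 / 4, 1 / 2 <= 'd g x u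
      & g (P t' s') - g (P t s) = (t' - t) * 'd g x w + (s' - s) * 'd g x u].
  have conv (a b k : R) : `|a| <= r -> `|b| <= r -> 0 <= k <= 1 ->
      `|a + k * (b - a)| <= r.
    rewrite !ler_norml => /andP[a1 a2] /andP[b1 b2] /andP[k0 k1].
    by apply/andP; split; nra.
  move=> tr sr tr' sr'.
  have in_box k : k \in `[0, 1] -> [/\ U (P t s + k *: (P t' s' - P t s)),
      `|'d g (P t s + k *: (P t' s' - P t s)) w| <= 1 / 4
      & 1 / 2 <= 'd g (P t s + k *: (P t' s' - P t s)) u].
    by rewrite in_itv /= => k01; rewrite segP; apply: hr; exact: conv.
  have [k k01|k k01] := @mean_value_segment _ _ g (P t s) (P t' s' - P t s).
    by apply: gC1.1; have [] := in_box k k01.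
  have [_ A B] := in_box k k01; rewrite segP in A B *.
  rewrite (addrC (P t s)) subrK => ->; exists k; first by move: k01; rewrite in_itv.
  split=> //; rewrite -[in RHS]/( _ *: _ + _ *: _) -!linearZ -linearD.
  by congr ('d g _ _); rewrite /P opprD addrACA subrr add0r opprD addrACA -!scalerBl.
have P00 : P 0 0 = p by rewrite /P !scale0r !addr0.
have z0 : `|0 : R| <= r by rewrite normr0 ltW.
(* At [s = r] and [s = - r] the transversal contribution has size at least [r / 2], the tangential
   one at most [r / 4]. The value [0] outside [|t| < r] only makes the choice total. *)
have solve t : exists s, `|t| < r -> `|s| <= r /\ g (P t s) = 0.
  have [tr|] := ltP `|t| r; last by exists 0.
  have rr : `|r| <= r by rewrite gtr0_norm.
  have rNr : `|- r| <= r by rewrite normrN gtr0_norm.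
  have [k1 _ [/=]] := mv 0 0 t r z0 z0 (ltW tr) rr.
  rewrite P00 gp !subr0 => A1 B1 E1.
  have [k2 _ [/=]] := mv 0 0 t (- r) z0 z0 (ltW tr) rNr.
  rewrite P00 gp !subr0 => A2 B2 E2.
  have small (a : R) : `|a| <= 1 / 4 -> `|t * a| <= r / 4.
    by move=> a4; rewrite normrM; have := ler_pM (normr_ge0 t) (normr_ge0 a) (ltW tr) a4; lra.
  have g1 : 0 <= g (P t r).
    by rewrite E1; move: (small _ A1); rewrite ler_norml => /andP[? _]; nra.
  have g2 : g (P t (- r)) <= 0.
    by rewrite E2; move: (small _ A2); rewrite ler_norml => /andP[_ ?]; nra.
  have [|||s] := @IVT R (fun s => g (P t s)) (- r) r 0.
  - by lra.
  - apply: continuous_in_subspaceT => s; rewrite inE /= in_itv /= -ler_norml => sr.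
    apply: (@continuous_comp _ _ _ (P t) g).
      apply: cvgD; first exact: cvg_cst.
      by apply: cvgD; [exact: cvg_cst|apply: cvgZr_tmp; exact: cvg_id].
    by apply/differentiable_continuous/gC1.1; have [] := hr t s (ltW tr) sr.
  - by rewrite ge_min g2 /= le_max g1 orbT.
  by rewrite in_itv /= -ler_norml => sr gs; exists s.
have [s hs] := choice solve.
pose gamma t := P t (s t).
have lip t t' : `|t| < r -> `|t'| < r -> exists2 k, 0 <= k <= 1 &
    let x := P (t + k * (t' - t)) (s t + k * (s t' - s t)) in
    s t' - s t = (t' - t) * - ('d g x w / 'd g x u)
    /\ `|s t' - s t| <= `|t' - t|.
  move=> tr tr'; have [sr gs] := hs t tr; have [sr' gs'] := hs t' tr'.
  have [k k01 [/= A B]] := mv _ _ _ _ (ltW tr) sr (ltW tr') sr'.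
  rewrite gs gs' subrr => E0; exists k => //=.
  set x := P _ _ in A B E0 *.
  have B0 : 0 < 'd g x u by lra.
  have E1 : s t' - s t = (t' - t) * - ('d g x w / 'd g x u).
    apply: (mulIf (lt0r_neq0 B0)); rewrite mulrN mulNr mulrA divfK ?gt_eqF //.
    by lra.
  split=> //; rewrite E1 normrM normrN ler_piMr // normrM normfV (gtr0_norm B0).
  by rewrite ler_pdivrMr //; lra.
pose quot x := - ('d g x w / 'd g x u).
have quot_cvg x : U x -> 1 / 2 <= 'd g x u -> quot y @[y --> x] --> quot x.
  move=> Ux ux; apply: cvgN; apply: cvgM; first exact: diff_cvg.
  by apply: cvgV; [rewrite gt_eqF //; lra|exact: diff_cvg].
have gamma_box t : `|t| < r -> U (gamma t) /\ 1 / 2 <= 'd g (gamma t) u.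
  by move=> tr; have [sr _] := hs t tr; have [A _ B] := hr t (s t) (ltW tr) sr.
(* The increment of [s] is [h] times the slope at an intermediate point, which is within
   [|h| * (|w| + |u|)] of [gamma t]; continuity of the slope bounds the remainder. *)
have dgamma t : `|t| < r -> differentiable gamma t
    /\ forall h, 'd gamma t h = h *: (w + quot (gamma t) *: u).
  move=> tr; apply: differentiable_curve => e e0.
  have [Ut ut] := gamma_box t tr.
  pose e1 := e / (`|u| + 1).
  have u0 : 0 < `|u| + 1 by rewrite ltr_wpDl.
  have e10 : 0 < e1 by rewrite divr_gt0.
  have e1u : e1 * `|u| <= e.
    by rewrite /e1 mulrAC ler_pdivrMr // ler_pM2l // lerDl.
  have /cvgrPdist_le/(_ _ e10)/nbhs_ballP[d /= d0 hd] := quot_cvg _ Ut ut.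
  have k0 : 0 < `|w| + `|u| + 1 by rewrite ltr_wpDl // addr_ge0.
  pose d1 := d / (`|w| + `|u| + 1).
  have d1E : d1 * (`|w| + `|u| + 1) = d by rewrite divfK // gt_eqF.
  apply/nbhs_ballP; exists (Num.min (r - `|t|) d1) => /=.
    by rewrite lt_min subr_gt0 tr divr_gt0.
  move=> h; rewrite -ball_normE /= sub0r normrN lt_min => /andP[hr1 hd1].
  have thr : `|t + h| < r by apply: le_lt_trans (ler_normD _ _) _; lra.
  have [k /andP[k0' k1] []] := lip t (t + h) tr thr.
  rewrite (addrC t h) addrK -(addrC t h).
  set x := P _ _; rewrite -/(quot x) => E1 E2.
  have xball : ball (gamma t) d x.
    rewrite -ball_normE /= /x /gamma /P opprD addrACA subrr add0r opprD addrACA.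
    rewrite -!scalerBl !opprD !addNKr; apply: le_lt_trans (ler_normD _ _) _.
    rewrite !normrZ !normrN !normrM (ger0_norm k0').
    have A : k * `|h| <= `|h| by rewrite ler_piMl.
    have B : k * `|s (t + h) - s t| <= `|h|.
      by apply: le_trans E2; rewrite ler_piMl.
    have := ler_wpM2r (normr_ge0 w) A; have := ler_wpM2r (normr_ge0 u) B.
    have : `|h| * (`|w| + `|u| + 1) < d by rewrite -d1E ltr_pM2r.
    by have := normr_ge0 h; lra.
  have := hd x xball => /= q.
  have -> : gamma (t + h) - gamma t - h *: (w + quot (gamma t) *: u)
      = (h * (quot x - quot (gamma t))) *: u.
    rewrite mulrBr -E1 /gamma /P opprD addrACA subrr add0r opprD addrACA.
    rewrite -!scalerBl (addrC t h) addrK scalerDr opprD addrACA subrr add0r.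
    by rewrite scalerA -scalerBl.
  rewrite normrZ normrM mulrAC mulrC -(distrC (quot x)) in q *.
  have := ler_wpM2r (normr_ge0 u) q.
  have := normr_ge0 h => h0 qq; nra.
have in_r t : t \in `]-r, r[ -> `|t| < r by rewrite in_itv /= ltr_norml.
(* Between [(0, 0)] and [(0, s 0)] the mean value theorem gives [0 = s 0 * 'd g x u] with a nonzero
   last factor. *)
have s0 : s 0 = 0.
  have r00 : `|0 : R| < r by rewrite normr0.
  have [sr gs] := hs 0 r00.
  have [k _ [/=]] := mv 0 0 0 (s 0) z0 z0 z0 sr; set x := P _ _ => _ B.
  rewrite P00 gp gs !subr0 mul0r add0r => /esym/eqP.
  by rewrite mulf_eq0 => /orP[|] /eqP // B0; move: B; rewrite B0; lra.
have g0 : gamma 0 = p by rewrite /gamma s0 P00.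
exists r, gamma; split=> //.
- split=> [t /in_r /dgamma[] //|v].
  apply: continuous_in_subspaceT => t /set_mem /= /in_r tr.
  have [Ut ut] := gamma_box t tr.
  have near_r : \forall y \near t, `|y| < r.
    have : `|y| @[y --> t] --> `|t| by apply: cvg_norm; exact: cvg_id.
    by move=> /cvgr_lt; apply.
  have E1 : \forall y \near t, v *: (w + quot (gamma y) *: u) = 'd gamma y v.
    by apply: filterS near_r => y /dgamma[_ ->].
  have Et := (dgamma t tr).2 v.
  suff lim_d : 'd gamma y v @[y --> t] --> v *: (w + quot (gamma t) *: u).
    by move: lim_d; rewrite -Et.
  apply: cvg_trans (near_eq_cvg E1) _.
  apply: cvgZl_tmp; apply: cvgD; first exact: cvg_cst.
  apply: cvgZr_tmp; apply: continuous_comp; last exact: quot_cvg.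
  exact/differentiable_continuous/(dgamma t tr).1.
- by move=> t /in_r tr; have [_ gs] := hs t tr; have [Ut _] := gamma_box t tr.
- have r00 : `|0 : R| < r by rewrite normr0.
  have [d0 dE] := dgamma 0 r00.
  by rewrite derive1E' // dE scale1r g0 /quot gw mul0r oppr0 scale0r addr0.
Qed.

End implicit_curve.

(** * Tangent and supporting hyperplanes of a C^1 convex body *)

Section normals_of_body.
Context {R : realType} {n : nat}.
Implicit Types (S V : set 'rV[R]_n) (p x y z nu w u : 'rV[R]_n).

Lemma hypersurface_tangent_kernel S p : C1_hypersurface S -> S p ->
  exists g : 'rV[R]_n -> R, (exists v, 'd g p v != 0) /\
    forall w, 'd g p w = 0 -> tangent_space S p w.
Proof.
move=> hS Sp; have [U [g [oU Up gC1 gnz SU]]] := hS p Sp.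
have SUP x : (S x /\ U x) <-> (U x /\ g x = 0).
  by have /seteqP[A B] := SU; split=> [/A|/B].
have gp : g p = 0 by have [] := (SUP p).1 (conj Sp Up).
have [v gv] := gnz p Up; exists g; split; first by exists v.
move=> w gw; pose u := ('d g p v)^-1 *: v.
have gu : 'd g p u = 1 by rewrite /u linearZ /= [_ *: _]mulVf.
have [e [gamma [e0 gammaC1 gU g0 gd]]] := implicit_curve oU Up gC1 gp gw gu.
exists e, gamma; split=> // t /gU[Ut gt].
by have [] := (SUP (gamma t)).2 (conj Ut gt).
Qed.

(** The form [dotv nu] vanishes on the kernel of ['d g p], hence is a multiple of it, and a nonzero
    one because [nu != 0]. The two kernels therefore coincide. *)
Lemma hypersurface_normal_tangent S p nu w : C1_hypersurface S -> S p ->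
  nu != 0 -> (forall v, tangent_space S p v -> dotv nu v = 0) ->
  dotv nu w = 0 -> tangent_space S p w.
Proof.
move=> hS Sp nu0 nuT nuw.
have [g [[v gv] gT]] := hypersurface_tangent_kernel hS Sp; apply: (gT).
have dot_g z : dotv nu z = 'd g p z / 'd g p v * dotv nu v.
  pose z' := z - ('d g p z / 'd g p v) *: v.
  have : dotv nu z' = 0.
    apply/nuT/gT; rewrite /z' linearB linearZ /= [_ *: 'd g p v]divfK //.
    by rewrite subrr.
  by rewrite /z' dotvBr dotvZr => /eqP; rewrite subr_eq0 => /eqP.
have nuv : dotv nu v != 0.
  apply/eqP => nuv; have := dotvv_gt0 nu0.
  by rewrite (dot_g nu) nuv mulr0 ltxx.
apply/eqP; have /esym/eqP := dot_g w; rewrite nuw.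
by rewrite !mulf_eq0 invr_eq0 (negbTE gv) (negbTE nuv) !orbF.
Qed.

Lemma compact_boundary_sub V : compact V -> boundary V `<=` V.
Proof.
move=> cV z [+ _]; suff <- : V = closure V by [].
by apply/closure_id; apply: compact_closed => //; exact: norm_hausdorff.
Qed.

Lemma convex_set_comb V x y (t : R) :
  convex_set (V : set (convex_lmodType 'rV[R]_n)) ->
  V x -> V y -> 0 <= t -> t <= 1 -> V (t *: x + (1 - t) *: y).
Proof.
move=> cV Vx Vy t0 t1.
by have := cV x y (Itv01 t0 t1) (mem_set Vx) (mem_set Vy); rewrite inE.
Qed.

(** A point [z] near [(1 - t) x] is [t z' + (1 - t) x] with [z'] near [0], hence [z'] in [V]. *)
Lemma convex_interior_shrink V x (t : R) :
  convex_set (V : set (convex_lmodType 'rV[R]_n)) ->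
  V° 0 -> V x -> 0 < t -> t <= 1 -> V° ((1 - t) *: x).
Proof.
move=> cV V0 Vx t0 t1.
pose x0 := (1 - t) *: x.
have sub_cvg : z - x0 @[z --> x0] --> x0 - x0.
  by apply: (@cvgB _ _ _ (nbhs x0) _ id (cst x0)); [exact: cvg_id|exact: cvg_cst].
have := @cvgZl_tmp _ _ _ (nbhs x0) _ t^-1 _ _ sub_cvg; rewrite subrr scaler0.
move=> /(_ (nbhs_filter x0) V V0) near_V.
apply: (@filterS _ (nbhs x0) _ _ _ _ near_V) => z Vz.
have -> : z = t *: (t^-1 *: (z - (1 - t) *: x)) + (1 - t) *: x.
  by rewrite scalerA divff ?gt_eqF // scale1r subrK.
by apply: convex_set_comb => //; exact: ltW.
Qed.

(* If [x] is interior and [dotv nu (x - y) > 0], write [nu = a (x - y) + w] with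
   [w] tangent at [y]; then [y + t nu] is a convex combination of a boundary point
   near [y + t w] and a point near [x], so it stays in [V]. *)
Lemma outward_normal_interior V y nu x : C1_convex_body V -> boundary V y ->
  nu != 0 -> outward_normal V y nu -> V° x -> dotv nu (x - y) <= 0.
Proof.
move=> [[cV convV _] hV] bVy nu0 [nuT nuout] Vx; rewrite leNgt; apply/negP => pos.
pose a := dotv nu nu / dotv nu (x - y).
have a0 : 0 < a by rewrite divr_gt0 // dotvv_gt0.
pose w := nu - a *: (x - y).
have nuw : dotv nu w = 0 by rewrite /w dotvBr dotvZr divfK ?gt_eqF // subrr.
have [e [gamma [e0 [dgamma _] gS g0 gw]]] :=
  hypersurface_normal_tangent hV bVy nu0 nuT nuw.
have d0 : differentiable gamma 0.
  by apply: dgamma; rewrite /= in_itv /= oppr_lt0 e0.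
have VbV := compact_boundary_sub cV.
pose q (t : R) := t^-1 *: (gamma (0 + t *: 1) - gamma 0).
have qw : q t @[t --> (0 : R)^'+] --> w.
  by rewrite -gw derive1E' //; exact: cvg_right_quotient.
(* Solved from [y + t nu = (t a) z + (1 - t a) gamma t]; since [q t] tends to [w], [z t] tends to
   [x]. *)
pose z (t : R) := y + a^-1 *: (nu - (1 - t * a) *: q t).
have zx : z t @[t --> (0 : R)^'+] --> x.
  have -> : x = y + a^-1 *: (nu - (1 - 0 * a) *: w).
    rewrite mul0r subr0 scale1r /w subKr scalerA mulVf ?gt_eqF // scale1r.
    by rewrite addrC subrK.
  apply: cvgD; first exact: cvg_cst.
  apply: cvgZl_tmp; apply: cvgB; first exact: cvg_cst.
  apply: cvgZ => //; apply: cvgB; first exact: cvg_cst.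
  by apply: cvgMr_tmp; apply: cvg_at_right_filter; exact: cvg_id.
have zV : \forall t \near (0 : R)^'+, V (z t) by exact: (zx V Vx).
have comb (b t : R) (y' m v : 'rV[R]_n) : b != 0 -> y' + t *: m
    = (t * b) *: (y' + b^-1 *: (m - (1 - t * b) *: v)) + (1 - t * b) *: (y' + t *: v).
  by move=> b0; apply/rowP => i; rewrite !mxE; field.
near (0 : R)^'+ => t.
have t0 : 0 < t by [].
have : ~ V (y + t *: nu) by near: t.
apply; have ta0 : 0 < t * a by rewrite mulr_gt0.
have -> : y + t *: nu = (t * a) *: z t + (1 - t * a) *: gamma t.
  have -> : gamma t = y + t *: q t.
    rewrite /q scalerA divff ?gt_eqF // scale1r g0 add0r [t *: 1]mulr1.
    by rewrite addrC subrK.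
  by apply: comb; rewrite gt_eqF.
apply: convex_set_comb => //.
- by near: t.
- apply/VbV/gS; rewrite in_itv /=; apply/andP; split.
    by apply: lt_trans t0; rewrite oppr_lt0.
  by near: t; exact: nbhs_right_lt.
- exact: ltW.
- rewrite -ler_pdivlMr // mul1r; near: t; apply: nbhs_right_ltW.
  by rewrite invr_gt0.
Unshelve. all: by end_near. Qed.

(** The interior points [(1 - t) x] approximate [x]. The chosen [t] gives [c - t |d| = t c + t > 0],
    so a violation at [x] would persist at [(1 - t) x]. *)
Lemma outward_normal_supporting V y nu x : C1_convex_body V -> V° 0 ->
  boundary V y -> nu != 0 -> outward_normal V y nu -> V x ->
  dotv nu (x - y) <= 0.
Proof.
move=> bV V0 bVy nu0 onu Vx; rewrite leNgt; apply/negP => pos.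
pose d := dotv nu x; pose c := dotv nu (x - y).
have D0 : 0 < c + `|d| + 1 by rewrite ltr_wpDl // addr_ge0 // ltW.
pose t := c / (c + `|d| + 1).
have t0 : 0 < t by rewrite divr_gt0.
have t1 : t <= 1 by rewrite ler_pdivrMr // mul1r -addrA lerDl addr_ge0.
have tE : t * (c + `|d| + 1) = c by rewrite divfK ?gt_eqF.
have [[_ convV _] _] := bV.
have := outward_normal_interior bV bVy nu0 onu (convex_interior_shrink convV V0 Vx t0 t1).
have -> : (1 - t) *: x - y = (x - y) - t *: x.
  by rewrite scalerBl scale1r addrAC.
rewrite dotvBr dotvZr -/c -/d => h.
have h1 : t * d <= t * `|d| by rewrite ler_wpM2l ?ler_norm // ltW.
have h2 : 0 < t * c by rewrite mulr_gt0.
lra.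
Qed.

End normals_of_body.

(** * Necessity of the three conditions, and the equivalence *)

Lemma normals_of_C1_convex_body (R : realType) (n : nat) (K V : set 'rV[R]_n)
    (N : 'rV[R]_n -> 'rV[R]_n) :
  (forall y, K y -> enorm (N y) = 1) ->
  C1_convex_body V -> V° 0 -> K `<=` boundary V ->
  (forall y, K y -> outward_normal V y (N y)) ->
  [/\ forall y, K y -> 0 < dotv (N y) y,
      forall x y, K x -> K y -> dotv (N y) (x - y) <= 0
    & forall x y, K x -> K y -> dotv (N y) (x - y) = 0 -> N x = N y].
Proof.
move=> N1 bV V0 KV KN.
have NN y : K y -> dotv (N y) (N y) = 1.
  by move=> /N1 e1; rewrite -[LHS]sqr_sqrtr ?dotvv_ge0 // -/(enorm _) e1 expr1n.
have N0 y : K y -> N y != 0.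
  move=> /NN e1; apply/eqP => e0; move: e1; rewrite e0 dotv0r => /esym/eqP.
  by rewrite oner_eq0.
have supp y x : K y -> V x -> dotv (N y) (x - y) <= 0.
  by move=> Ky; apply: outward_normal_supporting => //; [exact: KV|exact: N0|exact: KN].
have VbV : boundary V `<=` V by have [[cV _ _] _] := bV; exact: compact_boundary_sub.
have pos y : K y -> 0 < dotv (N y) y.
  (* As [0] is interior, [s N y] lies in [V] for some [s > 0], and the supporting inequality there
     reads [s <= dotv (N y) y]. *)
  move=> Ky; have : s *: N y @[s --> (0 : R)^'+] --> (0 : 'rV[R]_n).
    rewrite -(scale0r (N y)); apply: cvgZr_tmp; apply: cvg_at_right_filter.
    exact: cvg_id.
  move=> /(_ V V0) near_V; near (0 : R)^'+ => s.
  have s0 : 0 < s by [].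
  have Vs : V (s *: N y) by near: s.
  by have := supp y _ Ky Vs; rewrite dotvBr dotvZr NN //; lra.
split=> // [x y Kx Ky|x y Kx Ky xy]; first by apply: supp => //; exact/VbV/KV.
(* The supporting hyperplane at [y] contains [x], so it also supports [V] at [x]; thus [N y] is
   orthogonal to the tangent space at [x], which contains every vector orthogonal to [N x]. *)
have perp w : dotv (N x) w = 0 -> dotv (N y) w = 0.
  move=> Nxw; apply: (@tangent_space_supporting _ _ (boundary V) x).
    move=> z /VbV Vz; have := supp y z Ky Vz; move: xy; rewrite !dotvBr; lra.
  have [_ hV] := bV; have [NxT _] := KN x Kx.
  exact: hypersurface_normal_tangent hV (KV x Kx) (N0 x Kx) NxT Nxw.
pose c := dotv (N x) (N y).
(* [N y - c N x] is orthogonal to [N x], hence to [N y] by [perp], hence to itself. *)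
have NyE : N y = c *: N x.
  apply/eqP; rewrite -subr_eq0; apply/eqP/eqP/negPn/negP => /dotvv_gt0.
  have w0 : dotv (N x) (N y - c *: N x) = 0 by rewrite dotvBr dotvZr NN // mulr1 subrr.
  by rewrite dotvBl dotvZl w0 (perp _ w0) mulr0 subr0 ltxx.
have c2 : c * c = 1.
  by have := NN y Ky; rewrite NyE dotvZl dotvZr NN // mulr1.
(* The sign follows from [dotv (N y) x = dotv (N y) y > 0] and [dotv (N x) x > 0]. *)
have cpos : 0 < c.
  have : 0 < dotv (N y) x by move: xy; rewrite dotvBr; have := pos y Ky; lra.
  by rewrite NyE dotvZl pmulr_lgt0 // pos.
have -> : N y = N x by rewrite NyE (_ : c = 1) ?scale1r //; nra.
by [].
Unshelve. all: by end_near. Qed.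

Theorem theorem1p13 (R : realType) (n : nat) (K : set 'rV[R]_n)
    (N : 'rV[R]_n -> 'rV[R]_n)
    (hK : compact K)
    (hNcont : {within K, continuous N})
    (hN1 : forall y, K y -> enorm (N y) = 1) :
  (exists V : set 'rV[R]_n,
     [/\ C1_convex_body V, V° 0, K `<=` boundary V
       & forall y, K y -> outward_normal V y (N y)])
  <->
  [/\ forall y, K y -> 0 < dotv (N y) y,
      forall x y, K x -> K y -> dotv (N y) (x - y) <= 0
    & forall x y, K x -> K y -> dotv (N y) (x - y) = 0 -> N x = N y].
Proof.
split=> [[V [bV V0 KV KN]]|[Npos Nle Neq]].
  exact: normals_of_C1_convex_body hN1 bV V0 KV KN.
exact: C1_convex_body_of_normals.
Qed.
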